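(* Let $m,n\ge 2$ and let $P_m,P_n$ be paths on $m$ and $n$ vertices. Let $\Delta$ be the maximum degree of $P_m\times P_n$. Then $$\chi''_{\Sigma}(P_m\times P_n)=\begin{cases}\Delta+1 & \text{if } m=n=3,\\ \Delta+2 & \text{otherwise.}\end{cases}$$
   Context: All graphs are finite and simple. A proper total $k$-coloring of a graph $G$ assigns to every vertex and every edge a color from $\{1,\dots,k\}$ such that adjacent vertices receive different colors, edges sharing an endpoint receive different colors, and no edge receives the same color as either of its endpoints. For such a coloring $c$ and a vertex $v$, let $f(v)=c(v)+\sum_{e\ni v} c(e)$. The coloring distinguishes adjacent vertices by sums if $f(u)\neq f(v)$ for every edge $uv$. $\chi''_{\Sigma}(G)$ denotes the smallest $k$ such that $G$ has a proper total $k$-coloring distinguishing adjacent vertices by sums. The product $G_1\times G_2$ is the Cartesian product: vertex set $V(G_1)\times V(G_2)$, with $(u_1,u_2)$ adjacent to $(v_1,v_2)$ iff either $u_1=v_1$ and $u_2v_2\in E(G_2)$, or $u_1v_1\in E(G_1)$ and $u_2=v_2$. *)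

(* Defs.v *)
From mathcomp Require Import all_boot.

Set Implicit Arguments.
Unset Strict Implicit.
Unset Printing Implicit Defensive.

Record sgraph := SGraph {
  vertex :> finType;
  adj : rel vertex;
  adj_sym : symmetric adj;
  adj_irr : irreflexive adj
}.

Definition edges (G : sgraph) : {set {set G}} :=
  [set [set p.1; p.2] | p : G * G & adj p.1 p.2].

Definition degree (G : sgraph) (v : G) : nat := #|[set u : G | adj v u]|.

Definition max_degree (G : sgraph) : nat := \max_(v : G) degree v.

(* A total coloring is a pair (cv, ce) of a vertex coloring and an edge
   coloring; the values of ce outside [edges G] are irrelevant. *)
Definition proper_total_coloring (G : sgraph) (k : nat)
    (cv : G -> nat) (ce : {set G} -> nat) : Prop :=
  [/\ (forall v : G, 1 <= cv v <= k) /\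
        (forall e, e \in edges G -> 1 <= ce e <= k),
      forall u v : G, adj u v -> cv u <> cv v,
      forall e1 e2, e1 \in edges G -> e2 \in edges G ->
        e1 != e2 -> e1 :&: e2 != set0 -> ce e1 <> ce e2 &
      forall e (v : G), e \in edges G -> v \in e -> ce e <> cv v].

Definition total_sum (G : sgraph) (cv : G -> nat) (ce : {set G} -> nat)
    (v : G) : nat :=
  cv v + \sum_(e in edges G | v \in e) ce e.

Definition sum_distinguishing (G : sgraph) (cv : G -> nat)
    (ce : {set G} -> nat) : Prop :=
  forall u v : G, adj u v -> total_sum cv ce u <> total_sum cv ce v.

Definition sum_total_colorable (G : sgraph) (k : nat) : Prop :=
  exists (cv : G -> nat) (ce : {set G} -> nat),
    proper_total_coloring k cv ce /\ sum_distinguishing cv ce.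

(* The relation chi''_Sigma(G) = k. *)
Definition is_chi_sum_total (G : sgraph) (k : nat) : Prop :=
  sum_total_colorable G k /\ forall j, sum_total_colorable G j -> k <= j.

Section Path.
Variable n : nat.

Definition path_adj : rel 'I_n :=
  fun i j => (i.+1 == j :> nat) || (j.+1 == i :> nat).

Lemma path_adj_sym : symmetric path_adj.
Proof. by move=> i j; rewrite /path_adj orbC. Qed.

Lemma path_adj_irr : irreflexive path_adj.
Proof. by move=> i; rewrite /path_adj orbb eqn_leq ltnn. Qed.

Definition path_graph : sgraph := SGraph path_adj_sym path_adj_irr.
End Path.

Section CartesianProduct.
Variables G1 G2 : sgraph.

Definition cart_adj : rel (G1 * G2) :=
  fun u v => (u.1 == v.1) && adj u.2 v.2 || adj u.1 v.1 && (u.2 == v.2).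

Lemma cart_adj_sym : symmetric cart_adj.
Proof.
move=> u v; rewrite /cart_adj (eq_sym u.1) (eq_sym u.2).
by rewrite (adj_sym u.1) (adj_sym u.2).
Qed.

Lemma cart_adj_irr : irreflexive cart_adj.
Proof. by move=> u; rewrite /cart_adj !adj_irr andbF. Qed.

Definition cart_prod : sgraph := SGraph cart_adj_sym cart_adj_irr.
End CartesianProduct.

(* Main.v *)
(** A vertex together with its incident edges carries [deg v + 1] distinct
    colors; with only [Delta + 1] colors, two adjacent vertices of degree [Delta]
    would both have sum [1 + ... + (Delta + 1)].  Such a pair exists in every grid
    except the 3 x 3 one.  For the upper bound, color the vertices 1 and 2 in a
    checkerboard pattern and the edges of each direction alternately with two
    colors that are at least 3 and not used in the other direction.  The 3 x 3
    grid has an explicit coloring with 5 colors. *)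

Require Import Defs.
From mathcomp Require Import all_boot zify.

Set Implicit Arguments.
Unset Strict Implicit.
Unset Printing Implicit Defensive.

Lemma set2_inj (T : finType) (x y a b : T) :
  [set x; y] = [set a; b] -> (x = a /\ y = b) \/ (x = b /\ y = a).
Proof.
move=> /setP E.
move: (E x) (E y) (E a) (E b); rewrite !inE !eqxx ?orbT /=.
move=> /esym Ex /esym Ey Ea Eb.
case/orP: Ex => /eqP xE; case/orP: Ey => /eqP yE; subst; auto.
- by move: Eb; rewrite orbb => /eqP ->; auto.
- by move: Ea; rewrite orbb => /eqP ->; auto.
Qed.

Lemma set2_injr (T : finType) (x y z : T) : [set x; y] = [set x; z] -> y = z.
Proof. by case/set2_inj => [[]//|[-> ->]]. Qed.

(** * Colors around a vertex of an arbitrary graph *)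

Section Stars.
Variable G : sgraph.
Implicit Types (u v : G) (cv : G -> nat) (ce : {set G} -> nat).

(** Keeping a list rather than a set makes repeated colors visible: properness at [v] becomes
    [uniq], and the distinguishing sum becomes [sumn]. *)
Definition star cv ce v : seq nat :=
  cv v :: [seq ce [set v; u] | u <- enum (adj v)].

Lemma mem_edges u v : adj u v -> [set u; v] \in edges G.
Proof. by move=> uv; apply/imsetP; exists (u, v); rewrite ?inE. Qed.

Lemma edges_at (e : {set G}) v :
  e \in edges G -> v \in e -> exists2 u, adj v u & e = [set v; u].
Proof.
case/imsetP => [[a b]]; rewrite inE /= => ab ->; rewrite !inE.
case/orP=> /eqP ->; first by exists b.
by exists a; rewrite 1?adj_sym // setUC.
Qed.

Lemma size_star cv ce v : size (star cv ce v) = (degree v).+1.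
Proof.
rewrite /= size_map -cardE /degree; congr _.+1.
by apply: eq_card => u; rewrite inE.
Qed.

Lemma total_sum_star cv ce v : total_sum cv ce v = sumn (star cv ce v).
Proof.
rewrite /total_sum /=; congr (_ + _).
rewrite sumnE big_map big_enum /=.
have inj : {in [set u | adj v u] &, injective (fun u => [set v; u])}.
  by move=> x y _ _ /set2_injr.
have E : [set e in edges G | v \in e] = [set [set v; u] | u in [set u | adj v u]].
  apply/setP => e; rewrite inE; apply/andP/imsetP => [[eG ve]|[u]].
    by have [u uv ->] := edges_at eG ve; exists u; rewrite ?inE.
  by rewrite inE => uv ->; split; [exact: mem_edges | rewrite !inE eqxx].
transitivity (\sum_(e in [set e in edges G | v \in e]) ce e).
  by apply: eq_bigl => e; rewrite inE.
rewrite E big_imset //=.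
by apply: eq_bigl => u; rewrite inE.
Qed.

(** Except between adjacent vertices, every conflict is seen from one vertex: two edges that meet
    share an end, and an edge meets its own end. *)
Lemma proper_total_coloringP k cv ce :
  proper_total_coloring k cv ce <->
  [/\ forall v, all (fun c => 1 <= c <= k) (star cv ce v),
      forall v, uniq (star cv ce v) &
      forall u v, adj u v -> cv u <> cv v].
Proof.
split.
  case=> [[rv re] vv ee ve]; split=> // v.
    apply/allP => c; rewrite inE => /orP[/eqP -> //|/mapP[u]].
    by rewrite mem_enum => uv ->; apply/re/mem_edges.
  rewrite /=; apply/andP; split.
    apply/negP => /mapP[u]; rewrite mem_enum => uv.
    by apply/nesym/(ve [set v; u]); rewrite ?mem_edges // !inE eqxx.
  rewrite map_inj_in_uniq ?enum_uniq // => x y.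
  rewrite !mem_enum => vx vy; apply: contra_eq => xy; apply/eqP/ee.
  - exact: mem_edges.
  - exact: mem_edges.
  - by apply: contra_neq xy => /set2_injr.
  - by apply/set0Pn; exists v; rewrite !inE eqxx.
case=> range un vv; split=> //.
- split=> [v|e]; first by case/andP: (range v).
  case/imsetP => [[u v]]; rewrite inE /= => uv ->.
  case/andP: (range u) => _ /allP; apply; apply/mapP; exists v => //.
  by rewrite mem_enum.
- move=> e1 e2 e1G e2G ne /set0Pn[v]; rewrite inE => /andP[v1 v2].
  have [x vx E1] := edges_at e1G v1; have [y vy E2] := edges_at e2G v2.
  move: (un v) => /andP[_]; rewrite E1 E2 => U E.
  suff xy : x = y by rewrite E1 E2 xy eqxx in ne.
  (* Two edges at [v] with equal colors occupy the same position of a duplicate-free list, hence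
     have the same other end. *)
  have /(@uniqP _ 0) I := U.
  have Hx : x \in enum (adj v) by rewrite mem_enum.
  have Hy : y \in enum (adj v) by rewrite mem_enum.
  move: (I (index x (enum (adj v))) (index y (enum (adj v)))).
  rewrite !inE !size_map !index_mem !(nth_map x) ?index_mem // !nth_index //.
  by move/(_ Hx Hy E)/(congr1 (nth x (enum (adj v)))); rewrite !nth_index.
- move=> e v eG vE; have [x vx E] := edges_at eG vE.
  move: (un v) => /andP[/negP N _] F; apply: N; apply/mapP; exists x.
    by rewrite mem_enum.
  by rewrite -E F.
Qed.

Lemma colorable_gt_degree k v : sum_total_colorable G k -> degree v < k.
Proof.
move=> [cv [ce [/proper_total_coloringP[range un _] _]]].
rewrite -(size_star cv ce) -(size_iota 1 k); apply: uniq_leq_size => // c.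
by move/(allP (range v)); rewrite mem_iota add1n ltnS.
Qed.

(* With deg v + 1 colors, every color occurs exactly once at v. *)
Lemma colorable_saturated k u v : sum_total_colorable G k ->
  adj u v -> degree u = degree v -> (degree v).+1 != k.
Proof.
move=> [cv [ce [/proper_total_coloringP[range un _] dist]]] uv duv.
apply/eqP => dk; apply: (dist _ _ uv); rewrite !total_sum_star.
have P x : (degree x).+1 = k -> perm_eq (star cv ce x) (iota 1 k).
  move=> dx; have sub : {subset star cv ce x <= iota 1 k}.
    by move=> c /(allP (range x)); rewrite mem_iota add1n ltnS.
  have [|_ E] := uniq_min_size (un x) sub; first by rewrite size_iota size_star dx.
  by apply: uniq_perm; rewrite ?iota_uniq.
by rewrite (perm_sumn (P _ _)) ?(perm_sumn (P v _)) ?duv.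
Qed.

(** Transfers a weight on ordered pairs to unordered edges; for symmetric [w] the orientation picked
    is irrelevant. *)
Definition edge_color (w : G -> G -> nat) (e : {set G}) : nat :=
  if [pick p : G * G | e == [set p.1; p.2]] is Some p then w p.1 p.2 else 0.

Lemma edge_colorE w u v :
  (forall x y, w x y = w y x) -> edge_color w [set u; v] = w u v.
Proof.
move=> wC; rewrite /edge_color; case: pickP => [[x y] /= /eqP|/(_ (u, v))].
  by case/set2_inj => [[-> ->]|[-> ->]].
by rewrite eqxx.
Qed.

End Stars.

(** * Grids in integer coordinates *)

Section Grid.
Variables m n : nat.
Notation grid := (cart_prod (path_graph m) (path_graph n)).

Definition coord (v : grid) : nat * nat := (val v.1, val v.2).

Lemma coord_inj : injective coord.
Proof. by move=> [a b] [c d] [/val_inj -> /val_inj ->]. Qed.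

(** The order left, right, up, down is that of [grid_star] below, so coloring the edges along this
    list yields the tail of [grid_star] term by term. *)
Definition grid_nbrs (p : nat * nat) : seq (nat * nat) :=
  let: (i, j) := p in
  (if 0 < j then [:: (i, j.-1)] else [::]) ++
  (if j.+1 < n then [:: (i, j.+1)] else [::]) ++
  (if 0 < i then [:: (i.-1, j)] else [::]) ++
  (if i.+1 < m then [:: (i.+1, j)] else [::]).

Lemma perm_grid_nbrs (v : grid) :
  perm_eq [seq coord u | u <- enum (adj v)] (grid_nbrs (coord v)).
Proof.
apply: uniq_perm.
- by rewrite map_inj_uniq ?enum_uniq //; apply: coord_inj.
- case: v => [[i im] [j jn]]; rewrite /coord /grid_nbrs /=.
  by case: ifP; case: ifP; case: ifP; case: ifP => ? ? ? ? //=;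
     rewrite ?inE ?xpair_eqE; lia.
move=> [a b]; have -> : ((a, b) \in grid_nbrs (coord v)) =
   [&& a < m, b < n & (val v.1 == a) && ((val v.2).+1 == b)
     || (val v.1 == a) && (b.+1 == val v.2)
     || (val v.2 == b) && ((val v.1).+1 == a)
     || (val v.2 == b) && (a.+1 == val v.1)].
  case: v => [[i im] [j jn]]; rewrite /coord /grid_nbrs /=.
  by case: ifP; case: ifP; case: ifP; case: ifP => ? ? ? ? //=;
     rewrite ?in_nil ?inE ?xpair_eqE; lia.
apply/mapP/and3P => [[u]|[am bn E]].
  rewrite mem_enum => uv [-> ->]; move: uv.
  case: u v => [[a' am] [b' bn]] [[i im] [j jn]].
  rewrite unfold_in /= /cart_adj /= /path_adj -!val_eqE /= => uv.
  by split=> //; lia.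
exists (Ordinal am, Ordinal bn) => //; rewrite mem_enum.
case: v E => [[i im] [j jn]].
rewrite unfold_in /= /cart_adj /= /path_adj -!val_eqE /=; lia.
Qed.

Lemma degree_grid (v : grid) : degree v = size (grid_nbrs (coord v)).
Proof.
rewrite -(perm_size (perm_grid_nbrs v)) size_map -cardE /degree.
by apply: eq_card => u; rewrite inE.
Qed.

Section Coloring.
Variables (k : nat) (cv h w : nat -> nat -> nat).

(* [h i j] colors the edge from (i, j) to (i, j+1), and [w i j] the edge from
   (i, j) to (i+1, j). *)
Definition grid_star (i j : nat) : seq nat :=
  cv i j ::
  (if 0 < j then [:: h i j.-1] else [::]) ++
  (if j.+1 < n then [:: h i j] else [::]) ++
  (if 0 < i then [:: w i.-1 j] else [::]) ++
  (if i.+1 < m then [:: w i j] else [::]).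

Definition grid_separated (i j i' j' : nat) : bool :=
  (cv i j != cv i' j') && (sumn (grid_star i j) != sumn (grid_star i' j')).

(** Reduces colorability to arithmetic on [grid_star]. Separation is symmetric, so testing each
    vertex against its successor in each direction suffices. *)
Lemma grid_colorable :
  (forall i j, i < m -> j < n -> all (fun c => 1 <= c <= k) (grid_star i j)) ->
  (forall i j, i < m -> j < n -> uniq (grid_star i j)) ->
  (forall i j, i < m -> j.+1 < n -> grid_separated i j i j.+1) ->
  (forall i j, i.+1 < m -> j < n -> grid_separated i j i.+1 j) ->
  sum_total_colorable grid k.
Proof.
move=> range un seph sepw.
(* The minima select the end of the edge by which [h] and [w] index it. *)
pose c (a b : nat * nat) :=
  if a.1 == b.1 then h a.1 (minn a.2 b.2) else w (minn a.1 b.1) (minn a.2 b.2).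
pose wt (u v : grid) := c (coord u) (coord v).
have wtC u v : wt u v = wt v u.
  rewrite /wt /c ![minn (coord u).1 _]minnC ![minn (coord u).2 _]minnC eq_sym.
  by case: eqP => // ->.
pose cvG (v : grid) := cv (coord v).1 (coord v).2.
have starE v :
    perm_eq (star cvG (edge_color wt) v) (grid_star (coord v).1 (coord v).2).
  rewrite perm_cons.
  have -> : [seq edge_color wt [set v; u] | u <- enum (adj v)] =
            map (c (coord v)) (map coord (enum (adj v))).
    by rewrite -map_comp; apply: eq_map => u /=; rewrite edge_colorE.
  rewrite (perm_trans (perm_map _ (perm_grid_nbrs v))) // /grid_nbrs.
  case: (coord v) => i j /=.
  have cl : 0 < j -> c (i, j) (i, j.-1) = h i j.-1.
    by rewrite /c /= eqxx => j0; congr h; lia.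
  have cr : c (i, j) (i, j.+1) = h i j by rewrite /c /= eqxx; congr h; lia.
  have cu : 0 < i -> c (i, j) (i.-1, j) = w i.-1 j.
    by rewrite /c /= => i0; rewrite ifF; [congr w; lia | lia].
  have cd : c (i, j) (i.+1, j) = w i j.
    by rewrite /c /= ifF; [congr w; lia | lia].
  by case: ifP; case: ifP; case: ifP; case: ifP => ? ? ? ? /=;
     rewrite ?cl ?cr ?cu ?cd.
have sep (u v : grid) : adj u v ->
    cvG u != cvG v /\ sumn (grid_star (coord u).1 (coord u).2) !=
                      sumn (grid_star (coord v).1 (coord v).2).
  case: u v => [[i im] [j jn]] [[i' im'] [j' jn']].
  rewrite /= /cart_adj /= /path_adj -!val_eqE /cvG /coord /= => uv.
  apply/andP; rewrite -/(grid_separated i j i' j').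
  have sepC a b a' b' : grid_separated a b a' b' = grid_separated a' b' a b.
    by rewrite /grid_separated eq_sym (eq_sym (sumn _)).
  case/orP: uv => /andP[].
    move/eqP => ?; subst i' => /orP[]/eqP ?; subst; first exact: seph.
    by rewrite sepC; apply: seph.
  move=> E /eqP ?; subst j'; case/orP: E => /eqP ?; subst; first exact: sepw.
  by rewrite sepC; apply: sepw.
exists cvG, (edge_color wt); split.
  apply/proper_total_coloringP; split=> [v|v|u v uv].
  - by rewrite (perm_all _ (starE v)); apply: range; apply: ltn_ord.
  - by rewrite (perm_uniq (starE v)); apply: un; apply: ltn_ord.
  - by apply/eqP; case: (sep _ _ uv).
move=> u v uv; rewrite !total_sum_star (perm_sumn (starE u)) (perm_sumn (starE v)).
by apply/eqP; case: (sep _ _ uv).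
Qed.

End Coloring.

Lemma max_degree_grid : 2 <= m -> 2 <= n ->
  max_degree grid = 2 + (2 < m) + (2 < n).
Proof.
move=> m2 n2; apply/eqP; rewrite eqn_leq; apply/andP; split.
  apply/bigmax_leqP => -[[i im] [j jn]] _.
  rewrite degree_grid /grid_nbrs /= !size_cat.
  by case: ifP; case: ifP; case: ifP; case: ifP => ? ? ? ? /=; lia.
(* Since [m2] and [n2] read [1 < m] and [1 < n], this is the vertex (1, 1), which has two neighbors
   along every side longer than 2. *)
have := leq_bigmax (F := @degree grid) (Ordinal m2, Ordinal n2).
by rewrite degree_grid /grid_nbrs /= !size_cat; do 2 case: ifP.
Qed.

(* The two colors of the vertices differ by 1, whereas the sums of the edge
   colors at adjacent vertices are equal or differ by a single edge color,
   hence by at least 3.  Replacing 6 by 5 when [n = 2] saves one color. *)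
Lemma grid_colorable_add2 : 2 <= m -> 2 <= n ->
  sum_total_colorable grid (4 + (2 < m) + (2 < n)).
Proof.
move=> m2 n2.
apply: (@grid_colorable _ (fun i j => 1 + (odd i (+) odd j))
  (fun _ j => if odd j then 5 else 3)
  (fun i _ => if odd i then 5 + (2 < n) else 4)) => i j im jn.
all: rewrite /grid_separated /grid_star.
all: case: i im => [|[|i]] im; case: j jn => [|[|j]] jn /=.
all: try case: (odd i); try case: (odd j); rewrite /=.
all: do ?[case: ifP => ? /=]; rewrite ?inE; lia.
Qed.

Lemma saturated_grid_edge : 2 <= m -> 2 <= n -> ~~ ((m == 3) && (n == 3)) ->
  exists u v : grid, [/\ adj u v, degree u = max_degree grid
                                & degree v = max_degree grid].
Proof.
move=> m2 n2 mn33; rewrite max_degree_grid //.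
(* A neighbor of (1, 1) of the same degree: along a side of length 2 step back to index 0, as both
   ends look alike; along a side of length at least 4 step to index 2, still interior. Only the 3 x
   3 grid has no such side. *)
have [a [b [am bn E D]]] : exists a b, [/\ a < m, b < n,
    (a == 1) && ((b == 0) || (b == 2)) || (b == 1) && ((a == 0) || (a == 2)) &
    size (grid_nbrs (a, b)) = 2 + (2 < m) + (2 < n)].
  rewrite /grid_nbrs; have [n_2|n_n2] := eqVneq n 2.
    by exists 1, 0; split=> //=; do ?case: ifP => /=; lia.
  have [n_3|n_n3] := eqVneq n 3.
    have [m_2|m_n2] := eqVneq m 2.
      by exists 0, 1; split=> //=; do ?case: ifP => /=; lia.
    by exists 2, 1; split=> //=; do ?case: ifP => /=; lia.
  by exists 1, 2; split=> //=; do ?case: ifP => /=; lia.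
exists (Ordinal m2, Ordinal n2), (Ordinal am, Ordinal bn); split.
- by rewrite /= /cart_adj /= /path_adj -!val_eqE /=; lia.
- by rewrite degree_grid /grid_nbrs /= !size_cat; do 2 case: ifP.
- by rewrite degree_grid.
Qed.

End Grid.

(* The coloring was found by exhaustive search. *)
Lemma grid33_colorable :
  sum_total_colorable (cart_prod (path_graph 3) (path_graph 3)) 5.
Proof.
apply: (@grid_colorable 3 3 5
  (fun i j => nth 0 (nth [::] [:: [:: 1; 2; 1]; [:: 2; 1; 2]; [:: 1; 4; 3]] i) j)
  (fun i j => nth 0 (nth [::] [:: [:: 3; 4]; [:: 3; 4]; [:: 3; 5]] i) j)
  (fun i j => nth 0 (nth [::] [:: [:: 4; 5; 3]; [:: 5; 2; 1]] i) j)) => i j;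
  by case: i => [|[|[|i]]] // _; case: j => [|[|[|j]]].
Qed.

Theorem theorem4p1 (m n : nat) (hm : 2 <= m) (hn : 2 <= n) :
  let G := cart_prod (path_graph m) (path_graph n) in
  is_chi_sum_total G
    (if (m == 3) && (n == 3) then max_degree G + 1 else max_degree G + 2).
Proof.
(* The case [k = 0] is separate: it is refuted at an actual vertex, whereas a maximum over vertices
   only gives [max_degree G <= k] from [k.+1] colors. *)
move=> G; have Dlt k : sum_total_colorable G k -> max_degree G < k.
  move=> colk; case: k colk => [|k] colk; last first.
    by apply/bigmax_leqP => v _; rewrite -ltnS; apply: colorable_gt_degree.
  by have := colorable_gt_degree ((Ordinal hm, Ordinal hn) : G) colk.
case: ifPn => [/andP[/eqP ? /eqP ?]|mn33]; split.
- by subst m n; rewrite max_degree_grid //; apply: grid33_colorable.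
- by move=> k /Dlt; rewrite addn1.
- have -> : max_degree G + 2 = 4 + (2 < m) + (2 < n).
    by rewrite max_degree_grid //; lia.
  exact: grid_colorable_add2.
(* The saturated edge rules out exactly [max_degree G + 1] colors, and [Dlt] everything below. *)
move=> k colk; have [u [v [uv du dv]]] := saturated_grid_edge hm hn mn33.
have := colorable_saturated colk uv; rewrite du dv => /(_ erefl).
by have := Dlt k colk; rewrite -/G; lia.
Qed.
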